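(* Let $0<p<1$ and let $\ell^p$ be the space of real sequences $x=(x_k)_{k\ge1}$ with $\sum_{k=1}^\infty|x_k|^p<\infty$, equipped with the translation invariant metric $d(x,y)=\sum_{k=1}^\infty|y_k-x_k|^p$ and the linear topology it generates. Let $\Omega$ be an open convex subset of $\ell^p$. If $f:\Omega\to\mathbb{R}$ is continuous and convex, then $f$ is locally Lipschitz on $\Omega$ with respect to $d$, that is, every $x_0\in\Omega$ has a neighborhood $V\subset\Omega$ for which there is $L\ge0$ with $|f(x)-f(y)|\le L\,d(x,y)$ for all $x,y\in V$. *)

(* Defs.v *)
From HB Require Import structures.
From mathcomp Require Import all_boot all_order all_algebra.
From mathcomp Require Import all_classical all_reals all_analysis.

Set Implicit Arguments.
Unset Strict Implicit.
Unset Printing Implicit Defensive.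

Import Order.TTheory GRing.Theory Num.Theory.
Import numFieldNormedType.Exports.

Local Open Scope classical_set_scope.
Local Open Scope ring_scope.

Section powR_subadditive.
Context {R : realType} {p : R} (hp : 0 < p < 1).

Lemma powR_subadd (a b : R) : 0 <= a -> 0 <= b ->
  (a + b) `^ p <= a `^ p + b `^ p.
Proof.
have [p0 p1] := andP hp.
move=> a0 b0; have [s0|s0] := eqVneq (a + b) 0.
  by rewrite s0 powR0 ?gt_eqF// addr_ge0// powR_ge0.
have {}s0 : 0 < a + b by rewrite lt0r s0 addr_ge0.
have H c : 0 <= c -> c <= a + b -> c / (a + b) * (a + b) `^ p <= c `^ p.
  rewrite le_eqVlt => /predU1P[<- _|c0 cs]; first by rewrite !mul0r powR_ge0.
  rewrite -{2}(divfK (lt0r_neq0 s0) c) powRM ?divr_ge0 ?(ltW c0) ?(ltW s0)//.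
  rewrite ler_wpM2r ?powR_ge0// ger1_powR ?(ltW p1)//.
  by rewrite divr_gt0//= ler_pdivrMr// mul1r.
rewrite (le_trans _ (lerD (H a a0 _) (H b b0 _))) ?lerDl ?lerDr//.
by rewrite -mulrDl -mulrDl divff ?mul1r// gt_eqF.
Qed.

Lemma powR_norm_subadd (a b : R) : `|a + b| `^ p <= `|a| `^ p + `|b| `^ p.
Proof.
apply: le_trans (powR_subadd (normr_ge0 a) (normr_ge0 b)).
by rewrite ge0_ler_powR ?nnegrE ?addr_ge0 ?ler_normD//; case/andP: hp => /ltW.
Qed.

End powR_subadditive.

Section lp_space.
Context {R : realType}.

(* Sequences are indexed from 0 instead of 1. *)
Definition lp_pred (p : R) (hp : 0 < p < 1) : {pred nat -> R^o} :=
  fun x => `[< cvgn (series (fun k => `|x k| `^ p)) >].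

Definition lp_sum (p : R) (x : nat -> R) : R :=
  limn (series (fun k => `|x k| `^ p)).

Context {p : R} (hp : 0 < p < 1).

Let p0 : 0 < p. Proof. by case/andP: hp. Qed.

Lemma lp_predP (x : nat -> R^o) :
  reflect (cvgn (series (fun k => `|x k| `^ p))) (x \in lp_pred hp).
Proof. exact: asboolP. Qed.

Lemma lp_submod_closed : submod_closed (lp_pred hp).
Proof.
split.
  apply/lp_predP; rewrite (_ : series _ = cst 0); first exact: is_cvg_cst.
  apply/funext => n; rewrite /series/= big1// => k _.
  by rewrite normr0 powR0// gt_eqF.
move=> a x y /lp_predP cx /lp_predP cy; apply/lp_predP.
apply: (@series_le_cvg _ _
    (`|a| `^ p *: (fun k => `|x k| `^ p : R^o) + fun k => `|y k| `^ p)).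
- by move=> k; exact: powR_ge0.
- by move=> k; rewrite /= addr_ge0 ?mulr_ge0 ?powR_ge0.
- move=> k; apply: le_trans (powR_norm_subadd hp _ _) _.
  by rewrite normrM powRM.
- by apply: is_cvg_seriesD => //; exact: is_cvg_seriesZ.
Qed.

HB.instance Definition _ :=
  GRing.isSubmodClosed.Build R (nat -> R^o) (lp_pred hp) lp_submod_closed.

Record lp : Type := Lp {
  lp_seq :> nat -> R^o ;
  lp_seqP : lp_seq \in lp_pred hp }.

HB.instance Definition _ := [isSub for lp_seq].
HB.instance Definition _ := [Choice of lp by <:].
HB.instance Definition _ := [SubChoice_isSubLmodule of lp by <:].

Definition lp_dist (x y : lp) : R := lp_sum p (fun k => y k - x k).

Lemma lp_cvg (x : lp) : cvgn (series (fun k => `|x k| `^ p)).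
Proof. exact/lp_predP/lp_seqP. Qed.

Lemma lp_distE (x y : lp) : lp_dist x y = lp_sum p (y - x).
Proof. by []. Qed.

Lemma lp_sum_ge (x : lp) n : series (fun k => `|x k| `^ p) n <= lp_sum p x.
Proof.
apply: nondecreasing_cvgn_le; last exact: lp_cvg.
by apply: nondecreasing_series => k _ _; exact: powR_ge0.
Qed.

Lemma lp_sum_subadd (x y : lp) : lp_sum p (x + y) <= lp_sum p x + lp_sum p y.
Proof.
rewrite /lp_sum -lim_seriesD; [|exact: lp_cvg..].
apply: lim_series_le; [exact: (@lp_cvg (x + y))| |].
  by apply: is_cvg_seriesD; exact: lp_cvg.
by move=> k; exact: powR_norm_subadd.
Qed.

Lemma lp_sumZ (a : R) (x : lp) : lp_sum p (a *: x) = `|a| `^ p * lp_sum p x.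
Proof.
rewrite /lp_sum -[RHS](lim_seriesZ _ (@lp_cvg x)).
congr (limn (series _)); apply/funext => k /=.
by rewrite [LHS](_ : _ = `|a * x k| `^ p)// normrM powRM.
Qed.

Lemma lp_sum0 : lp_sum p (0 : lp) = 0.
Proof. by rewrite -(scale0r (0 : lp)) lp_sumZ normr0 powR0 ?mul0r// gt_eqF. Qed.

Lemma lp_sumN (x : lp) : lp_sum p (- x) = lp_sum p x.
Proof. by rewrite -scaleN1r lp_sumZ normrN1 powR1 mul1r. Qed.

Lemma lp_distxx (x : lp) : lp_dist x x = 0.
Proof. by rewrite lp_distE subrr lp_sum0. Qed.

Lemma lp_dist_positivity (x y : lp) : lp_dist x y = 0 -> x = y.
Proof.
rewrite lp_distE => xy0; apply/esym/eqP; rewrite -subr_eq0; apply/eqP.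
apply/val_inj/funext => k /=; apply/eqP; rewrite -normr_eq0.
have : `|(y - x) k| `^ p <= 0.
  rewrite -xy0; apply: le_trans (lp_sum_ge (y - x) k.+1).
  by rewrite seriesSr lerDr sumr_ge0// => i _; exact: powR_ge0.
by rewrite le_eqVlt ltNge powR_ge0 orbF powR_eq0 => /andP[].
Qed.

Lemma lp_dist_sym (x y : lp) : lp_dist x y = lp_dist y x.
Proof. by rewrite !lp_distE -opprB lp_sumN. Qed.

Lemma lp_dist_triangle (y x z : lp) :
  lp_dist x z <= lp_dist x y + lp_dist y z.
Proof.
rewrite !lp_distE [leRHS]addrC.
have -> : z - x = (z - y) + (y - x) by rewrite addrA subrK.
exact: lp_sum_subadd.
Qed.

HB.instance Definition _ := isMetric.Build R lp
  lp_distxx lp_dist_positivity lp_dist_sym lp_dist_triangle.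

Lemma lp_mdistE (x y : lp) : mdist x y = lp_dist x y.
Proof. by []. Qed.

Lemma lp_dist_translation (z x y : lp) :
  mdist (x + z) (y + z) = mdist x y.
Proof. by rewrite !lp_mdistE !lp_distE opprD addrACA subrr addr0. Qed.

Let lp_add_continuous : continuous (fun x : lp * lp => x.1 + x.2).
Proof.
move=> [x y]; apply/metricType_numDomainType.cvgrPdist_lt => e e0.
have e20 : 0 < e / 2 by rewrite divr_gt0.
near=> z; rewrite /= lp_mdistE lp_distE opprD addrACA.
apply: le_lt_trans (lp_sum_subadd _ _) _; rewrite (splitr e) ltrD//.
- suff: mdist x z.1 < e / 2 by [].
  near: z; apply: (metricType_numDomainType.cvgr_dist_lt _ e20).
  exact: cvg_fst.
- suff: mdist y z.2 < e / 2 by [].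
  near: z; apply: (metricType_numDomainType.cvgr_dist_lt _ e20).
  exact: cvg_snd.
Unshelve. all: by end_near. Qed.

Let lp_scale_continuous : continuous (fun z : R^o * lp => z.1 *: z.2).
Proof.
move=> [a x]; apply/metricType_numDomainType.cvgrPdist_lt => e e0.
pose C := (`|a| + 1) `^ p.
have C0 : 0 < C by rewrite powR_gt0// ltr_wpDl.
pose S := lp_sum p x + 1.
have Sx0 : 0 <= lp_sum p x.
  by apply: le_trans (@lp_sum_ge x 0); rewrite /series/= big_geq.
have S0 : 0 < S by rewrite ltr_wpDl.
pose d := (e / 2 / S) `^ p^-1.
have d0 : 0 < d by rewrite powR_gt0// !divr_gt0.
have eC0 : 0 < e / 2 / C by rewrite !divr_gt0.
near=> z; rewrite /= lp_mdistE lp_distE.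
have -> : z.1 *: z.2 - a *: x = z.1 *: (z.2 - x) + (z.1 - a) *: x.
  by rewrite scalerBr scalerBl addrA subrK.
apply: le_lt_trans (lp_sum_subadd _ _) _; rewrite !lp_sumZ (splitr e) ltr_leD//.
- have zx : mdist x z.2 < e / 2 / C.
    near: z; apply: (metricType_numDomainType.cvgr_dist_lt _ eC0).
    exact: cvg_snd.
  have za : `|z.1| <= `|a| + 1.
    rewrite -lerBlDl; apply: le_trans (lerB_dist _ _) _; rewrite distrC.
    near: z; apply: (@cvgr_dist_le _ R^o _ _ _ _ a) => //; exact: cvg_fst.
  apply: (@le_lt_trans _ _ (C * mdist x z.2)).
    apply: ler_wpM2r; first exact: (mdist_ge0 x z.2).
    by apply: ge0_ler_powR => //; rewrite ?ltW// nnegrE addr_ge0.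
  by rewrite mulrC -ltr_pdivlMr.
- have za : `|z.1 - a| <= d.
    rewrite distrC.
    near: z; apply: (@cvgr_dist_le _ R^o _ _ _ _ a) => //; exact: cvg_fst.
  apply: (@le_trans _ _ (d `^ p * S)).
    apply: ler_pM; rewrite ?powR_ge0 ?lerDl//.
    by apply: ge0_ler_powR => //; rewrite ?nnegrE ltW.
  rewrite /d -powRrM mulVf ?gt_eqF// powRr1 ?divfK ?gt_eqF//.
  by rewrite !divr_ge0 ?ltW.
Unshelve. all: by end_near. Qed.

HB.instance Definition _ :=
  PreTopologicalNmodule_isTopologicalNmodule.Build lp lp_add_continuous.
HB.instance Definition _ :=
  TopologicalNmodule_isTopologicalLmodule.Build R lp lp_scale_continuous.

End lp_space.

(* Main.v *)
(* The convex set of the [w] with [f (x0 + w) <= f x0 + 1] contains a p-ball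
   around 0, hence its convex hull, hence an l^1-ball (intersected with l^p).
   Being bounded above there, [f] is Lipschitz near [x0] for the l^1 norm by
   the usual argument for convex functions, and the l^1 norm of a difference is
   at most its p-sum as soon as the latter is at most 1. *)
Require Import Defs.
From HB Require Import structures.
From mathcomp Require Import all_boot all_order all_algebra.
From mathcomp Require Import all_classical all_reals all_analysis.
From mathcomp Require Import lra ring.

Set Implicit Arguments.
Unset Strict Implicit.
Unset Printing Implicit Defensive.

Import Order.TTheory GRing.Theory Num.Theory.
Import numFieldNormedType.Exports.

Local Open Scope classical_set_scope.
Local Open Scope ring_scope.

(** * Convex combinations and sublevel sets in a module *)

Lemma convex_set_comb (R : numDomainType) (E : lmodType R) (A : set E) :
  @convex_set R E A -> forall t x y, 0 <= t <= 1 -> A x -> A y ->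
  A (t *: x + (1 - t) *: y).
Proof.
move=> cA t x y t01 Ax Ay.
have [t0 t1] := andP t01.
by have /set_mem := cA x y (Itv01 t0 t1) (mem_set Ax) (mem_set Ay).
Qed.

Lemma convex_function_comb (R : numFieldType) (E : lmodType R) (D : set E)
    (f : E -> R) :
  @convex_function R E D f -> forall t x y, 0 <= t <= 1 -> D x -> D y ->
  f (t *: x + (1 - t) *: y) <= t * f x + (1 - t) * f y.
Proof.
move=> cf t x y t01 Dx Dy.
exact: (cf (Itv01 (andP t01).1 (andP t01).2) x y (mem_set Dx) (mem_set Dy)).
Qed.

(** The sublevel set is taken in the translated variable [w], so that scalings and balls around 0
    can be used on it. *)
Lemma convex_sublevel (R : realFieldType) (E : lmodType R) (D : set E)
    (f : E -> R) (x0 : E) (M : R) :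
  @convex_set R E D -> @convex_function R E D f ->
  @convex_set R E [set w | D (x0 + w) /\ f (x0 + w) <= M].
Proof.
move=> cD cf x y l /set_mem[Dx fx] /set_mem[Dy fy]; apply/mem_set.
have l01 : 0 <= l%:num <= 1 by rewrite ge0 le1.
pose w : E := l%:num *: (x : E) + (1 - l%:num) *: (y : E).
have wE : x0 + w = l%:num *: (x0 + (x : E)) + (1 - l%:num) *: (x0 + (y : E)).
  by rewrite !scalerDr addrACA -scalerDl subrKC scale1r.
suff : D (x0 + w) /\ f (x0 + w) <= M by [].
rewrite wE; split; first exact: convex_set_comb.
apply: le_trans (convex_function_comb cf l01 Dx Dy) _.
have [l0 l1] := andP l01.
have -> : M = l%:num * M + (1 - l%:num) * M by rewrite -mulrDl subrKC mul1r.
by rewrite lerD// ler_wpM2l// subr_ge0.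
Qed.

(** By induction on [n]: the last term is split off and the other weights are divided by [1 - a n],
    so [a] has to vary in the induction. *)
Lemma convex_sum (R : realFieldType) (E : lmodType R) (A : set E)
    (a : nat -> R) (u : nat -> E) n :
  @convex_set R E A -> (forall k, 0 <= a k) ->
  (forall k, (k < n)%N -> A (u k)) -> \sum_(k < n) a k = 1 ->
  A (\sum_(k < n) a k *: u k).
Proof.
move=> cA; elim: n a => [|n IH] a a0 Au.
  by rewrite big_ord0 => /eqP; rewrite eq_sym oner_eq0.
rewrite !big_ord_recr/= => sa.
have s0 : 0 <= \sum_(k < n) a k by apply: sumr_ge0.
(* When [a n = 1] this division is impossible, but the other weights are nonnegative with sum 0,
   hence vanish. *)
have [an1|an1] := eqVneq (a n) 1.
  have /psumr_eq0P a00 : \sum_(k < n) a k = 0.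
    by apply: (addIr (a n)); rewrite sa an1 add0r.
  rewrite big1 => [|i _]; last by rewrite a00 ?scale0r.
  by rewrite add0r an1 scale1r; exact: Au.
have t0 : 1 - a n != 0 by rewrite subr_eq0 eq_sym.
have sE : \sum_(k < n) a k = 1 - a n by rewrite -sa addrK.
rewrite addrC (_ : \sum_(i < n) _ =
    (1 - a n) *: \sum_(i < n) ((1 - a n)^-1 * a i) *: u i); last first.
  by rewrite scaler_sumr; apply: eq_bigr => i _; rewrite scalerA mulVKf.
refine (convex_set_comb cA _ _ _); [|exact: Au|].
  by rewrite a0/= -sa lerDr.
apply: (IH (fun k => (1 - a n)^-1 * a k)).
- by move=> k; rewrite mulr_ge0// invr_ge0 -sE.
- by move=> k kn; apply: Au; rewrite ltnS ltnW.
- by rewrite -mulr_sumr sE mulVf.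
Qed.

(** * Coordinates, basis vectors and tails in [lp] *)

Section lp_coordinates.
Context {R : realType} {p : R} (hp : 0 < p < 1).

Let p0 : 0 < p. Proof. by case/andP: hp. Qed.

Lemma lpD (x y : lp hp) k : (x + y) k = x k + y k. Proof. by []. Qed.
Lemma lpN (x : lp hp) k : (- x) k = - x k. Proof. by []. Qed.
Lemma lpZ a (x : lp hp) k : (a *: x) k = a * x k. Proof. by []. Qed.

Lemma lp_ext (x y : lp hp) : (forall k, x k = y k) -> x = y.
Proof. by move=> xy; apply/val_inj/funext. Qed.

Lemma lp_coord_sum (I : Type) (s : seq I) (P : pred I) (F : I -> lp hp) k :
  (\sum_(i <- s | P i) F i) k = \sum_(i <- s | P i) F i k.
Proof. exact: (big_morph (fun x : lp hp => x k)). Qed.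

Lemma lp_sum_ge0 (x : lp hp) : 0 <= lp_sum p x.
Proof. by have := lp_sum_ge x 0; rewrite /series/= big_geq. Qed.

Lemma cvg_series_delta j :
  series (fun k => `|((k == j)%:R : R)| `^ p) @ \oo --> (1 : R).
Proof.
apply: cvg_near_cst; near=> n.
have jn : (j < n)%N by near: n; exact: nbhs_infty_gt.
rewrite /series/= big_mkord (bigD1 (Ordinal jn))//= eqxx normr1 powR1.
rewrite big1 ?addr0// => i /negbTE; rewrite -val_eqE/= => ->.
by rewrite normr0 powR0 ?gt_eqF.
Unshelve. all: by end_near. Qed.

Lemma lp_basis_subproof j :
  (fun k => (k == j)%:R : R^o) \in lp_pred hp.
Proof. by apply/lp_predP/cvgP; exact: cvg_series_delta. Qed.

Definition lp_basis j : lp hp := Lp (lp_basis_subproof j).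

Lemma lp_sum_basis j : lp_sum p (lp_basis j) = 1.
Proof. by apply/cvg_lim => //; exact: cvg_series_delta. Qed.

(** Written as a difference, so that membership in [lp] comes from the module structure. *)
Definition lp_tail (x : lp hp) n : lp hp :=
  x - \sum_(k < n) x k *: lp_basis k.

Lemma lp_tailE (x : lp hp) n k : lp_tail x n k = if (k < n)%N then 0 else x k.
Proof.
rewrite /lp_tail lpD lpN lp_coord_sum.
under eq_bigr => i _ do rewrite lpZ/=.
case: ltnP => kn.
  rewrite (bigD1 (Ordinal kn))//= eqxx mulr1 big1 ?addr0 ?subrr// => i.
  by rewrite -val_eqE/= eq_sym => /negbTE ->; rewrite mulr0.
rewrite big1 ?subr0// => i _; rewrite gtn_eqF ?mulr0//.
exact: leq_trans (ltn_ord i) kn.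
Qed.

Lemma lp_sum_tail (x : lp hp) n :
  lp_sum p (lp_tail x n) = lp_sum p x - series (fun k => `|x k| `^ p) n.
Proof.
apply/cvg_lim => //.
apply: (@cvg_trans _ ((fun m => series (fun k => `|x k| `^ p) m -
    series (fun k => `|x k| `^ p) n) @ \oo)); last first.
  by apply: cvgB; [exact: lp_cvg|exact: cvg_cst].
apply: near_eq_cvg; near=> m.
have nm : (n <= m)%N by near: m; exact: nbhs_infty_ge.
rewrite sub_series_geq// /series [RHS](big_cat_nat _ nm)//.
rewrite [X in _ = X + _]big_nat_cond [X in _ = X + _]big1 ?add0r; last first.
  by move=> i /andP[/andP[_ im] _]; rewrite lp_tailE im normr0 powR0 ?gt_eqF.
by apply: eq_big_nat => i /andP[ni _]; rewrite lp_tailE ltnNge ni.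
Unshelve. all: by end_near. Qed.

Lemma lp_sum_tail_cvg0 (x : lp hp) : lp_sum p (lp_tail x n) @[n --> \oo] --> 0.
Proof.
under eq_fun do rewrite lp_sum_tail.
rewrite -(subrr (lp_sum p x)).
by apply: cvgB; [exact: cvg_cst|exact: lp_cvg].
Qed.

(** A p-sum at most 1 forces each [|x k| <= 1], and there [|x k|] is at most its [p]-th power
    because [p < 1]. *)
Lemma sum_norm_le_lp_sum (x : lp hp) n :
  lp_sum p x <= 1 -> \sum_(k < n) `|x k| <= lp_sum p x.
Proof.
move=> x1; apply: le_trans (lp_sum_ge x n); rewrite /series/= big_mkord.
apply: ler_sum => i _.
have xi1 : `|x i| `^ p <= 1.
  apply: le_trans x1; apply: le_trans (lp_sum_ge x i.+1).
  by rewrite seriesSr lerDr sumr_ge0// => k _; exact: powR_ge0.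
have {}xi1 : `|x i| <= 1.
  rewrite leNgt; apply/negP => xi; move: xi1; apply/negP; rewrite -ltNge.
  have := gt0_ltr_powR p0 _ _ xi; rewrite powR1; apply; rewrite nnegrE //.

have [->|xi0] := eqVneq `|x i| 0; first exact: powR_ge0.
by rewrite ger1_powR ?lt0r ?xi0 ?normr_ge0// ltW//; case/andP: hp.
Qed.

(* A point of l^1-norm below [c] is a convex combination of the points
   [± c e_k] and of one rescaled tail, which has small p-sum. *)
Lemma convex_lp_l1_ball (C : set (lp hp)) (r c b : R) (x : lp hp) :
  convex_set C -> (forall y : lp hp, lp_sum p y < r -> C y) ->
  0 < c -> c `^ p < r -> b < c ->
  (forall n, \sum_(k < n) `|x k| <= b) -> C x.
Proof.
move=> cC ballC c0 cr bc xb.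
(* A lower bound, uniform in [n], for the weight [1 - s] left to the tail; it allows [n] to be
   chosen before [s] is known. *)
pose t0 := 1 - b / c.
have t00 : 0 < t0 by rewrite subr_gt0 ltr_pdivrMr// mul1r.
have r0 : 0 < r by apply: le_lt_trans cr; exact: powR_ge0.
have e0 : 0 < t0 `^ p * r by rewrite mulr_gt0// powR_gt0.
(* The threshold is such that dividing the tail by [1 - s >= t0] leaves a p-sum below [r]. *)
have [n nE] : exists n, lp_sum p (lp_tail x n) < t0 `^ p * r.
  have [n _ /(_ n (leqnn n))] := cvgr_lt _ (@lp_sum_tail_cvg0 x) _ e0.
  by exists n.
pose s := \sum_(k < n) `|x k| / c.
have sb : s <= b / c by rewrite /s -mulr_suml ler_pM2r ?invr_gt0.
have t0s : t0 <= 1 - s by rewrite lerD2l lerN2.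
have s1 : 0 < 1 - s by exact: lt_le_trans t0s.
(* Index [n] carries the tail. If [x k = 0] the sign is 0, and the point is 0, which is still in the
   ball. *)
pose a k := if (k < n)%N then `|x k| / c else 1 - s.
pose u k := if (k < n)%N then (c * Num.sg (x k)) *: lp_basis k
            else (1 - s)^-1 *: lp_tail x n.
have -> : x = \sum_(k < n.+1) a k *: u k.
  rewrite big_ord_recr/= /a /u ltnn scalerA divff ?gt_eqF// scale1r.
  rewrite [in RHS](eq_bigr (fun k : 'I_n => x k *: lp_basis k)).
    by rewrite addrC subrK.
  move=> i _; rewrite ltn_ord scalerA mulrA divfK ?gt_eqF//.
  by rewrite mulrC -numEsg.
apply: convex_sum => //.
- by move=> k; rewrite /a; case: ifP => _; rewrite ?divr_ge0// ltW.
- move=> k _; apply: ballC; rewrite /u; case: ifP => _; rewrite lp_sumZ.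
    rewrite lp_sum_basis mulr1; apply: le_lt_trans cr.
    apply: ge0_ler_powR; rewrite ?nnegrE ?(ltW p0) ?(ltW c0)//.
    by rewrite normrM gtr0_norm// ger_pMr// normr_sg lern1 leq_b1.
  rewrite gtr0_norm ?invr_gt0// -powR_inv1 ?ltW// -powRrM mulN1r.
  rewrite powRN mulrC ltr_pdivrMr ?powR_gt0//; apply: lt_le_trans nE _.
  rewrite mulrC ler_pM2l//.
  by apply: ge0_ler_powR; rewrite ?nnegrE ?(ltW p0) ?(ltW t00) ?(ltW s1).
- rewrite big_ord_recr/= {2}/a ltnn (eq_bigr (fun k : 'I_n => `|x k| / c)).
    by rewrite -/s addrC subrK.
  by move=> i _; rewrite /a ltn_ord.
Qed.

Lemma lp_nbhs_ball (x0 : lp hp) (P : set (lp hp)) : nbhs x0 P ->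
  exists2 r : R, 0 < r & forall w : lp hp, lp_sum p w < r -> P (x0 + w).
Proof.
move=> /(@nbhs_ballP R) [r /= r0 rP]; exists r => // w wr; apply: rP.
by rewrite ballEmdist/= lp_mdistE lp_distE addrC addKr.
Qed.

End lp_coordinates.

Theorem proposition8p1 (R : realType) (p : R) (hp : 0 < p < 1)
    (Omega : set (lp hp)) (f : lp hp -> R) :
  open Omega ->
  convex_set Omega ->
  {within Omega, continuous f} ->
  convex_function Omega f ->
  forall x0 : lp hp, Omega x0 ->
    exists V : set (lp hp),
      [/\ nbhs x0 V,
          V `<=` Omega
        & exists2 L : R, 0 <= L &
            forall x y : lp hp, V x -> V y ->
              `|f x - f y| <= L * mdist x y].
Proof.
move=> oO cO ctsf cf x0 Ox0.
have [p0 _] := andP hp.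
have ctsx0 : f x @[x --> x0] --> (f x0 : R^o).
  move: ctsf; rewrite continuous_open_subspace// => /(_ x0); apply.
  by rewrite inE.
(* Both sides of the bound serve: the upper one puts the ball inside [C], the lower one later
   compares [f x] with [f x0]. *)
have [r r0 rP] : exists2 r : R, 0 < r & forall w : lp hp, lp_sum p w < r ->
    Omega (x0 + w) /\ `|f x0 - f (x0 + w)| < 1.
  apply: (@lp_nbhs_ball _ _ _ x0 [set x | Omega x /\ `|f x0 - f x| < 1]).
  apply: filterI; first exact: open_nbhs_nbhs.
  by move/cvgrPdist_lt : ctsx0 => /(_ 1 ltr01).
pose C : set (lp hp) := [set w | Omega (x0 + w) /\ f (x0 + w) <= f x0 + 1].
have cC : convex_set C by exact: convex_sublevel.
have ballC (w : lp hp) : lp_sum p w < r -> C w.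
  move=> /rP [Ow]; rewrite ltr_norml => /andP[fw _]; split => //.
  by move: fw; lra.
(* Then the [p]-th power of [c] is [r / 2]. *)
pose c := (r / 2) `^ p^-1.
have c0 : 0 < c by rewrite powR_gt0// divr_gt0.
have cr : c `^ p < r.
  rewrite /c -powRrM mulVf ?gt_eqF// powRr1 ?divr_ge0 ?ltW//.
  by rewrite ltr_pdivrMr// mulr_natr mulr2n ltrDl.
(* The l^1 norm of [l *: w] is [l] times that of [w], itself at most the p-sum of [w]. *)
have CZ l (w : lp hp) : 0 <= l -> lp_sum p w <= 1 -> l * lp_sum p w < c ->
    C (l *: w).
  move=> l0 w1 lw; apply: (convex_lp_l1_ball cC ballC c0 cr lw) => n.
  under eq_bigr => i _ do rewrite lpZ normrM (ger0_norm l0).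
  by rewrite -mulr_sumr ler_wpM2l// sum_norm_le_lp_sum.
(* The halving keeps the distance of two points of the ball below 1, as [CZ] requires, and twice the
   distance to [x0] below [c]. *)
pose e := Num.min r (Num.min 1 c) / 2.
have m0 : 0 < Num.min r (Num.min 1 c) by rewrite !lt_min r0 ltr01.
have e0 : 0 < e by rewrite divr_gt0.
have e2 : e * 2 = Num.min r (Num.min 1 c) by rewrite divfK.
have er : e * 2 <= r by rewrite e2 ge_min lexx.
have e1 : e * 2 <= 1 by rewrite e2 !ge_min lexx orbT.
have ec : e * 2 <= c by rewrite e2 !ge_min lexx !orbT.
have Vr (x : lp hp) : mdist x0 x < e -> Omega x /\ `|f x0 - f x| < 1.
  rewrite lp_mdistE lp_distE => xe.
  by rewrite -(subrKC x0 x); apply: rP; lra.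
have lip (x y : lp hp) : mdist x0 x < e -> mdist x0 y < e ->
    f y - f x <= 8 / c * mdist x y.
  move=> xe ye; have [Ox] := Vr x xe; rewrite ltr_norml => /andP[_ fx].
  (* Set apart because [l] below is a quotient by the distance. *)
  have [->|xy] := eqVneq x y; first by rewrite subrr mdistxx mulr0.
  have dxy : mdist x y < e * 2.
    rewrite mulr_natr mulr2n; apply: le_lt_trans (metric_triangle _ x0 _) _.
    by rewrite ltrD// metric_sym.
  have : 0 < mdist x y by rewrite mdist_gt0.
  move: dxy ye; rewrite !lp_mdistE !lp_distE.
  set d := lp_sum p (y - x) => dxy ye d0.
  pose l := c / (4 * d).
  have l0 : 0 < l by rewrite divr_gt0// mulr_gt0.
  have ld : l * d = c / 4 by rewrite /l; field; rewrite gt_eqF.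
  (* [y] divides the segment from [x] to [x0 + w], a point where [f] is
     bounded above, in the ratio [l : 1] with [l] of order [1 / d]. *)
  pose w : lp hp := (y - x0) + l *: (y - x).
  have [Ow fw] : C w.
    (* [w] is the midpoint of two points that [CZ] puts in [C]: the first by [e * 2 <= c], the
       second by [2 * l * d = c / 2]. *)
    have -> : w = 2^-1 *: (2 *: (y - x0)) + (1 - 2^-1) *: ((2 * l) *: (y - x)).
      by apply: lp_ext => k; rewrite !(lpD, lpZ, lpN); field.
    apply: (convex_set_comb cC); first by lra.
    - by apply: CZ => //; lra.
    - apply: CZ; rewrite -?/d.
      + by rewrite mulr_ge0// ltW.
      + by lra.
      + by rewrite -mulrA ld; lra.
  pose t := (1 + l)^-1.
  have t0 : 0 < t by rewrite invr_gt0 addr_gt0.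
  have t1 : t <= 1 by rewrite invf_le1 ?lerDl ?addr_gt0// ltW.
  have yE : y = t *: (x0 + w) + (1 - t) *: x.
    apply: lp_ext => k; rewrite /w /t !(lpD, lpZ, lpN).
    by field; rewrite gt_eqF//; lra.
  have t01 : 0 <= t <= 1 by rewrite ltW.
  have := convex_function_comb cf t01 Ow Ox; rewrite -yE => fy.
  (* Since [f (x0 + w) <= f x0 + 1] and [f x0 - f x < 1], the increment from [x] to [x0 + w] is at
     most 2. With [t <= l^-1] this gives [2 / l], whence the constant [8 / c]. *)
  apply: (@le_trans _ _ (t * 2)); first by nra.
  have -> : 8 / c * d = l^-1 * 2 by rewrite /l; field; rewrite !gt_eqF.
  by rewrite ler_pM2r// lef_pV2 ?posrE; lra.
exists (ball x0 e); split; first exact: nbhsx_ballx.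
  by move=> x; rewrite ballEmdist => /Vr[].
exists (8 / c); first by rewrite divr_ge0// ltW.
move=> x y; rewrite !ballEmdist => xe ye.
by rewrite ler_norml lerNl opprB lip// [mdist x y]metric_sym lip.
Qed.
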